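(* Let $R$ be a commutative ring and $n\geq 2$ an integer. Then the diagonal extension $R\subseteq R^n$ has FCP if and only if $R$ is an Artinian ring.
   Context: All rings are commutative, unital and nonzero. For a ring extension $R\subseteq S$, $[R,S]$ is the set of all $R$-subalgebras of $S$; the extension has FCP if every chain (with respect to inclusion) of elements of $[R,S]$ is finite. *)

(* Defs.v *)
From HB Require Import structures.
From mathcomp Require Import all_boot all_algebra.
From mathcomp Require Import all_classical.

Set Implicit Arguments.
Unset Strict Implicit.
Unset Printing Implicit Defensive.

Import GRing.Theory.

Local Open Scope classical_set_scope.
Local Open Scope ring_scope.

(* R^n is {ffun 'I_n -> R} with the library's componentwise ring structure; the
   library proves ffun_mulC but does not declare the commutative instance. *)
HB.instance Definition _ (T : finType) (R : comPzRingType) :=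
  GRing.PzSemiRing_hasCommutativeMul.Build {ffun T -> R} (@ffun_mulC T R).

Section Diagonal.
Variables (n : nat) (R : comPzRingType).

Definition diag (x : R) : {ffun 'I_n -> R} := [ffun => x].

Fact diag_is_zmod_morphism : zmod_morphism diag.
Proof. by move=> x y; apply/ffunP=> i; rewrite !ffunE. Qed.

Fact diag_is_monoid_morphism : monoid_morphism diag.
Proof. by split=> [|x y]; apply/ffunP=> i; rewrite !ffunE. Qed.

HB.instance Definition _ :=
  Algebra.isZmodMorphism.Build R {ffun 'I_n -> R} diag diag_is_zmod_morphism.
HB.instance Definition _ :=
  GRing.isMonoidMorphism.Build R {ffun 'I_n -> R} diag diag_is_monoid_morphism.

Lemma diag_inj : (0 < n)%N -> injective diag.
Proof. by move=> n_gt0 x y /ffunP/(_ (Ordinal n_gt0)); rewrite !ffunE. Qed.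

End Diagonal.

Section Extension.
(* A ring extension is given by its inclusion map, an injective morphism f. *)
Variables (R S : comPzRingType) (f : {rmorphism R -> S}).

(* [R, S] *)
Definition intermediate_rings : set (set S) :=
  [set A | subring_closed (mem A) /\ range f `<=` A].

Definition FCP : Prop :=
  forall C : set (set S),
    C `<=` intermediate_rings -> total_on C subset -> finite_set C.

End Extension.

Arguments intermediate_rings {R S} f.
Arguments FCP {R S} f.

(* The library's idealr_closed is not used because it excludes the unit ideal. *)
Definition ideals (R : comPzRingType) : set (set R) :=
  [set I | [/\ I 0, forall x y, I x -> I y -> I (x + y)
                   & forall a x, I x -> I (a * x)]].

Arguments ideals R : clear implicits.

Definition artinian (R : comPzRingType) : Prop :=
  forall I : nat -> set R,
    (forall k, ideals R (I k)) -> (forall k, I k.+1 `<=` I k) ->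
    exists N, forall k, (N <= k)%N -> I k = I N.

(* Main.v *)
Require Import Defs.
From mathcomp Require Import all_boot all_algebra.
From mathcomp Require Import all_classical.

(** For an ideal I of R, the vectors of R^n whose coordinates all agree modulo I
form an intermediate ring, and I can be read off from it by looking at the
vectors supported on one coordinate. A descending sequence of ideals thus gives
a chain of intermediate rings, and under FCP this chain is finite, so the
sequence is stationary ([antitone_finite_range_stationary]).

Conversely, every intermediate ring is an R-submodule of R^n, and it is enough
that R Artinian forces every chain of submodules of R^n to be finite. Both the
passage from R to R^n and the case of R itself rest on a devissage
([finite_chain_devissage]): along a chain, X is determined by X :&: B and X + B,
by the modular law, so it suffices to bound the chain on both sides of B.

For R itself ([artinian_finite_chain]) this is the part of the Hopkins-Levitzki
theorem that says that an Artinian ring has finite length, in a form that avoids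
both the nilradical and composition series. Choose an ideal W minimal among
those above which all chains of ideals are finite. If W is nonzero, choose a
principal ideal (x) minimal among those with xW nonzero. Then for every a,
either a kills xW or (ax) = (x), so the ring R / ann(xW) is a field and xW is a
nonzero vector space over it. It has a hyperplane by Zorn's lemma; the inverse
image of the hyperplane under multiplication by x is a maximal proper subideal
W' of W ([artinian_maximal_subideal]). By devissage along W, chains of ideals
above W' are also finite, against the minimality of W. So W = 0.

For R^n ([finite_chain_submodules]) one filters by the submodules of vectors
supported on the first k coordinates: the kth coordinate identifies each
successive quotient with R, whose chains of ideals have been dealt with. *)

Set Implicit Arguments.
Unset Strict Implicit.
Unset Printing Implicit Defensive.

Import GRing.Theory.

Local Open Scope classical_set_scope.
Local Open Scope ring_scope.

(** * Chains of subsets *)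

Lemma total_on_image T U (C : set (set T)) (f : set T -> set U) :
  (forall X Y, C X -> C Y -> X `<=` Y -> f X `<=` f Y) ->
  total_on C subset -> total_on (f @` C) subset.
Proof.
move=> fS totC _ _ [X CX <-] [Y CY <-].
by case: (totC X Y CX CY) => [XY|YX]; [left|right]; apply: fS.
Qed.

(** Modular law: if X is contained in Y and the two have the same intersection
with B and the same sum with B, then X = Y. So the map sending X to the pair
(X :&: B, X + B) is injective on a chain, with values in a product of two finite
sets. *)
Lemma finite_chain_devissage (V : zmodType) (B : set V) (C : set (set V)) :
    B 0 -> (forall X, C X -> forall x y, X x -> X y -> X (x - y)) ->
    total_on C subset ->
    finite_set [set X `&` B | X in C] ->
    finite_set [set [set x + b | x in X & b in B] | X in C] ->
  finite_set C.
Proof.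
move=> B0 subC totC fI fD.
pose h (X : set V) := (X `&` B, [set x + b | x in X & b in B]).
have finh : finite_set (h @` C) := finite_image11 pair fI fD.
have modular X Y : C X -> C Y -> h X = h Y -> X `<=` Y -> Y `<=` X.
  move=> CX CY [eI eD] XY y Yy.
  have : [set x + b | x in Y & b in B] y.
    by exists y => //; exists 0; rewrite ?addr0.
  rewrite -eD => -[x Xx [b Bb xby]].
  have Xb : (X `&` B) b.
    rewrite eI; split=> //; rewrite -[b](addKr x) xby addrC.
    by apply: subC => //; apply: XY.
  have X0 : X 0 by rewrite -(subrr x); apply: subC.
  rewrite -xby -[b]opprK -(sub0r b); apply: (subC) => //; apply: (subC) => //.
  by case: Xb.
have h_inj : {in C &, injective h}.
  move=> X Y /set_mem CX /set_mem CY hXY; apply/seteqP.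
  by case: (totC X Y CX CY) => XY; split=> //; exact: modular _ _ XY.
by rewrite -(eq_finite_set (inj_card_eq h_inj)).
Qed.

Lemma antitone_le T (A : nat -> set T) (decA : forall k, A k.+1 `<=` A k) :
  {homo A : i j / (i <= j)%N >-> j `<=` i}.
Proof.
apply: (homo_leq (r := fun X Y => Y `<=` X)) => [X x //|Y X Z YX ZY|//].
exact: subset_trans ZY YX.
Qed.

(** If every value of the sequence is attained before the index N, then any later
term equals an earlier one, and the terms in between are squeezed. *)
Lemma antitone_finite_range_stationary T (A : nat -> set T) :
  (forall k, A k.+1 `<=` A k) -> finite_set (range A) ->
  exists N, forall k, (N <= k)%N -> A k = A N.
Proof.
move=> decA finA.
have mono := antitone_le decA.
have /choice[idx idxP] : forall X : set T, exists i, range A X -> A i = X.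
  by move=> X; have [[i _ <-]|nX] := pselect (range A X); [exists i|exists 0%N].
have /finite_seqP[s sE] := finite_image idx finA.
exists (\max_(i <- s) i) => k lek; apply/seteqP; split; first exact: mono.
have Ak : range A (A k) by exists k.
rewrite -[X in _ `<=` X](idxP _ Ak); apply: mono.
apply: (@leq_bigmax_seq _ s xpredT id) => //.
by have : (idx @` range A) (idx (A k)) by [exists (A k)]; rewrite sE.
Qed.

(** * Ideals of an Artinian ring *)

Section Ideals.
Variable R : comPzRingType.
Implicit Types (I J V W X : set R) (a b x y : R).

Lemma ideal0 I : ideals R I -> I 0. Proof. by case. Qed.

Lemma idealD I x y : ideals R I -> I x -> I y -> I (x + y).
Proof. by case=> _ + _; apply. Qed.

Lemma idealM I a x : ideals R I -> I x -> I (a * x).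
Proof. by case=> _ _; apply. Qed.

Lemma idealB I x y : ideals R I -> I x -> I y -> I (x - y).
Proof.
by move=> idI Ix Iy; apply: idealD => //; rewrite -mulN1r; apply: idealM.
Qed.

Lemma ideal_principal x : ideals R (range ( *%R^~ x)).
Proof.
split=> [|_ _ [a _ <-] [b _ <-]|a _ [b _ <-]].
- by exists 0; rewrite ?mul0r.
- by exists (a + b); rewrite ?mulrDl.
- by exists (a * b); rewrite ?mulrA.
Qed.

Lemma ideal_scale x I : ideals R I -> ideals R ( *%R x @` I).
Proof.
move=> idI; split=> [|_ _ [y Iy <-] [z Iz <-]|a _ [y Iy <-]].
- by exists 0; [exact: ideal0|rewrite mulr0].
- by exists (y + z); [exact: idealD|rewrite mulrDr].
- by exists (a * y); [exact: idealM|rewrite mulrCA].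
Qed.

Lemma ideal_preim_scale x I : ideals R I -> ideals R ( *%R x @^-1` I).
Proof.
move=> idI; split=> [|y z Iy Iz|a y Iy] /=.
- by rewrite mulr0; apply: ideal0.
- by rewrite mulrDr; apply: idealD.
- by rewrite mulrCA; apply: idealM.
Qed.

Lemma ideal_setI I J : ideals R I -> ideals R J -> ideals R (I `&` J).
Proof.
move=> idI idJ; split=> [|x y [? ?] [? ?]|a x [? ?]].
- by split; apply: ideal0.
- by split; apply: idealD.
- by split; apply: idealM.
Qed.

Lemma ideal_sum I J : ideals R I -> ideals R J ->
  ideals R [set x + y | x in I & y in J].
Proof.
move=> idI idJ.
split=> [|_ _ [x Ix [y Jy <-]] [x' Ix' [y' Jy' <-]]|a _ [x Ix [y Jy <-]]].
- by exists 0; [exact: ideal0|exists 0; [exact: ideal0|rewrite addr0]].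
- exists (x + x'); first exact: idealD.
  by exists (y + y'); [exact: idealD|rewrite addrACA].
- exists (a * x); first exact: idealM.
  by exists (a * y); [exact: idealM|rewrite mulrDr].
Qed.

Lemma artinian_minimal (P : set (set R)) : artinian R ->
  P `<=` ideals R -> P !=set0 ->
  exists2 I, P I & forall J, P J -> J `<=` I -> J = I.
Proof.
move=> artR Pid [I0 PI0]; apply: contrapT => noMin.
have /choice[next nextP] : forall I, exists J, P I -> [/\ P J, J `<=` I & J <> I].
  move=> I; have [PI|nPI] := pselect (P I); last by exists I.
  apply: contrapT => nJ; apply: noMin; exists I => // J PJ JI.
  by apply: contrapT => nJI; apply: nJ; exists J.
have Pk k : P (iter k next I0) by elim: k => //= k /nextP[].
have [||N /(_ N.+1 (leqnSn N))] := artR (fun k => iter k next I0).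
- by move=> k; apply/Pid/Pk.
- by move=> k /=; case: (nextP _ (Pk k)).
- by rewrite /=; case: (nextP _ (Pk N)).
Qed.

(** Among the principal ideals (x) with xW nonzero, take a minimal one: if a does
not kill xW, then (ax) is again such an ideal, hence equal to (x). The second
conclusion says that R / ann(xW) is a field. *)
Lemma artinian_simple_scale W : artinian R -> (exists2 w, W w & w <> 0) ->
  exists x, (exists2 w, W w & x * w <> 0) /\
    forall a, (forall w, W w -> a * (x * w) = 0) \/ exists b, b * (a * x) = x.
Proof.
move=> artR [w Ww w0].
(* The ideal (1) shows that the family is nonempty. *)
pose acts x := exists2 w, W w & x * w <> 0.
have [||_ [x actx <-] minx] :=
  @artinian_minimal [set range ( *%R^~ x) | x in acts] artR.
- by move=> _ [x _ <-]; apply: ideal_principal.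
- by exists (range ( *%R^~ 1)), 1 => //; exists w; rewrite ?mul1r.
exists x; split=> // a.
have [acta|nacta] := pselect (acts (a * x)).
  right; have : range ( *%R^~ x) x by exists 1; rewrite ?mul1r.
  rewrite -(minx (range ( *%R^~ (a * x)))); first by case=> b _ bax; exists b.
    by exists (a * x).
  by move=> _ [b _ <-]; exists (b * a); rewrite ?mulrA.
left=> v Wv; apply: contrapT => axv; apply: nacta.
by exists v => //; rewrite -mulrA.
Qed.

Definition maximal_subideal I J : Prop :=
  [/\ ideals R J, J `<=` I, J <> I &
     forall X, ideals R X -> J `<=` X -> X `<=` I -> X = J \/ X = I].

(** The last hypothesis says that V is a vector space over the field R / ann(V).
A subspace A maximal among those avoiding a nonzero vector v is a hyperplane:
for u outside A, the vector v lies in A + Ru with a coefficient of u that is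
invertible on V, so u lies in A + Rv. *)
Lemma maximal_subideal_exists V : ideals R V -> (exists2 v, V v & v <> 0) ->
  (forall a, (forall v, V v -> a * v = 0) \/
             exists b, forall v, V v -> b * (a * v) = v) ->
  exists A, maximal_subideal V A.
Proof.
move=> idV [v Vv v0] kills_or_inv.
(* The condition A 0 is left out of P so that the union of the empty chain
   satisfies P; it is recovered from maximality. *)
pose P (A : set R) := [/\ A `<=` V, forall x y, A x -> A y -> A (x + y),
  forall a x, A x -> A (a * x) & ~ A v].
have [F FP totF|A [[AV AD AM nAv] maxA]] := @Zorn_bigcup _ P.
  split=> [x [X FX Xx]|x y [X FX Xx] [Y FY Yy]|a x [X FX Xx]|[X FX Xv]].
  - by case: (FP X FX) => + _ _ _; apply.
  - case: (totF X Y FX FY) => XY.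
      by exists Y => //; case: (FP Y FY) => _ + _ _; apply=> //; apply: XY.
    by exists X => //; case: (FP X FX) => _ + _ _; apply=> //; apply: XY.
  - by exists X => //; case: (FP X FX) => _ _ + _; apply.
  - by case: (FP X FX) => _ _ _; apply.
have meets_v X : ideals R X -> A `<=` X -> X `<=` V -> ~ X `<=` A -> X v.
  move=> idX AX XV XA; apply: contrapT => nXv; apply: (maxA X).
    by split=> // -[].
  by split=> // [x y|a x]; [exact: idealD|exact: idealM].
have A0 : A 0.
  apply: contrapT => nA0.
  have A_empty x : ~ A x by move=> Ax; apply: nA0; rewrite -(mul0r x); apply: AM.
  suff : [set 0 : R] v by [].
  apply: meets_v => [|x /A_empty//|_ ->|/(_ 0 erefl)//]; last exact: ideal0.
  by split=> [|_ _ -> ->|a _ ->] //=; rewrite ?addr0 ?mulr0.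
have idA : ideals R A by [].
exists A; split=> // [AeqV|X idX AX XV]; first by apply: nAv; rewrite AeqV.
have [XA|nXA] := pselect (X `<=` A); [left|right]; apply/seteqP; split=> //.
have Xv : X v by apply: meets_v.
move=> u Vu; have [Au|nAu] := pselect (A u); first exact: AX.
have : [set x + y | x in A & y in range ( *%R^~ u)] v.
  apply: meets_v.
  - by apply: ideal_sum => //; apply: ideal_principal.
  - move=> x Ax; exists x => //; exists 0; last by rewrite addr0.
    by exists 0; rewrite ?mul0r.
  - move=> _ [x Ax [_ [r _ <-] <-]]; apply: idealD => //; first exact: AV.
    exact: idealM.
  - move=> sumA; apply/nAu/sumA; exists 0 => //; exists u; last by rewrite add0r.
    by exists 1; rewrite ?mul1r.
case=> x Ax [_ [r _ <-] xru]; have [ru|[b bru]] := kills_or_inv r.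
  by case: nAv; rewrite -xru ru // addr0.
rewrite -(bru u Vu) -[r * u](addKr x) xru addrC.
by apply: idealM => //; apply: idealB => //; apply: AX.
Qed.

(** Pulling back along multiplication by x from W onto the vector space xW keeps a
hyperplane maximal, since the kernel is contained in the inverse image. *)
Lemma artinian_maximal_subideal W : artinian R -> ideals R W ->
  (exists2 w, W w & w <> 0) -> exists W', maximal_subideal W W'.
Proof.
move=> artR idW /(artinian_simple_scale artR)[x [[w Ww xw0] simple_x]].
have idV := ideal_scale x idW.
have [||A [idA AV AneqV maxA]] := maximal_subideal_exists idV.
- by exists (x * w) => //; exists w.
- move=> a; have [ax0|[b bax]] := simple_x a; [left|right].
    by move=> _ [y Wy <-]; apply: ax0.
  by exists b => _ [y _ <-]; rewrite !mulrA -(mulrA b) bax.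
exists (W `&` *%R x @^-1` A); split.
- by apply: ideal_setI => //; apply: ideal_preim_scale.
- by move=> ? [].
- move=> eqW; apply/AneqV/seteqP; split=> // _ [y Wy <-].
  by move: Wy; rewrite -eqW => -[].
move=> X idX W'X XW.
have AX : A `<=` *%R x @` X.
  move=> a Aa; have [y Wy xya] := AV a Aa.
  by exists y => //; apply: W'X; split=> //; rewrite /= xya.
have XV : *%R x @` X `<=` *%R x @` W by apply: image_subset.
have [eqA|eqV] := maxA _ (ideal_scale x idX) AX XV; [left|right].
  apply/seteqP; split=> // y Xy; split; first exact: XW.
  by rewrite /= -eqA; exists y.
apply/seteqP; split=> // y Wy.
have : ( *%R x @` W) (x * y) by exists y.
rewrite -eqV => -[z Xz xzy]; rewrite -(subrK z y); apply: idealD => //.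
apply: W'X; split; first by apply: idealB => //; apply: XW.
by rewrite /= mulrBr xzy subrr; apply: ideal0.
Qed.

(** The ideals W such that all chains of ideals above W are finite have a minimal
element; a maximal subideal of it would again be of this kind, so it is 0. *)
Lemma artinian_finite_chain (C : set (set R)) : artinian R ->
  C `<=` ideals R -> total_on C subset -> finite_set C.
Proof.
move=> artR Cid totC.
pose finite_above W := forall D : set (set R), D `<=` ideals R ->
  (forall X, D X -> W `<=` X) -> total_on D subset -> finite_set D.
have [||W [idW finW] minW] :=
  @artinian_minimal [set W | ideals R W /\ finite_above W] artR.
- by move=> W [].
- exists setT; split=> // D _ DT _; apply: (sub_finite_set _ (finite_set1 setT)).
  by move=> X DX; apply/seteqP; split=> //; apply: DT.
suff W0 : forall w, W w -> w = 0.
  by apply: finW => // X /Cid idX w /W0 ->; apply: ideal0.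
apply: contrapT => /existsNP[w /not_implyP[Ww w0]].
have [|W' [idW' W'W W'neqW simple]] := artinian_maximal_subideal artR idW.
  by exists w.
apply: W'neqW; apply: minW => //; split=> // D Did DW' totD.
apply: (@finite_chain_devissage _ W) => //.
- exact: ideal0.
- by move=> X /Did idX x y; apply: idealB.
- apply: sub_finite_set (finite_set2 W' W) => _ [X DX <-]; apply: simple.
  + by apply: ideal_setI => //; apply: Did.
  + by move=> x W'x; split; [exact: DW' W'x|exact: W'W].
  + by move=> x [].
apply: finW.
- by move=> _ [X /Did idX <-]; apply: ideal_sum.
- move=> _ [X /Did idX <-] x Wx; exists 0; first exact: ideal0.
  by exists x; rewrite ?add0r.
apply: total_on_image totD => X Y _ _ XY _ [x Xx [y Wy <-]].
by exists x; [exact: XY|exists y].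
Qed.

End Ideals.

(** * Submodules of R^n *)

Section Power.
Variables (R : comPzRingType) (n : nat).
Implicit Types (f : {ffun 'I_n -> R}) (k : nat) (N : set {ffun 'I_n -> R}).

Definition submodules : set (set {ffun 'I_n -> R}) :=
  [set N | [/\ N 0, forall f g, N f -> N g -> N (f - g)
                 & forall a f, N f -> N (@diag n R a * f)]].

Definition supported_below k : set {ffun 'I_n -> R} :=
  [set f | forall i : 'I_n, (k <= i)%N -> f i = 0].

Lemma submodule_setI_supported N k :
  submodules N -> submodules (N `&` supported_below k).
Proof.
case=> N0 NB NM; split=> [|f g [Nf f0] [Ng g0]|a f [Nf f0]].
- by split=> // i _; rewrite ffunE.
- by split; [exact: NB|move=> i ki; rewrite !ffunE f0 ?g0 ?subrr].
- by split; [exact: NM|move=> i ki; rewrite !ffunE f0 ?mulr0].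
Qed.

Lemma ideal_coordinate N (i : 'I_n) :
  submodules N -> ideals R [set f i | f in N].
Proof.
case=> N0 NB NM; split=> [|_ _ [f Nf <-] [g Ng <-]|a _ [f Nf <-]].
- by exists 0; rewrite ?ffunE.
- exists (f - (0 - g)); last by rewrite !ffunE sub0r opprK.
  by apply: (NB) => //; apply: NB.
- by exists (@diag n R a * f); [exact: NM|rewrite !ffunE].
Qed.

(** Induction on k for submodules supported below k, with devissage along the
submodule supported below k. *)
Lemma finite_chain_submodules (C : set (set {ffun 'I_n -> R})) :
  artinian R -> C `<=` submodules -> total_on C subset -> finite_set C.
Proof.
move=> artR Csub totC.
suff finite_below k : (k <= n)%N -> forall D, D `<=` submodules ->
    (forall X, D X -> X `<=` supported_below k) -> total_on D subset ->
    finite_set D.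
  by apply: (finite_below n) => // X _ f _ i; rewrite leqNgt ltn_ord.
elim: k => [_ D Dsub D0 _|k IH ltkn D Dsub Dk totD].
  apply: sub_finite_set (finite_set1 [set 0]) => X DX; apply/seteqP; split.
    by move=> f /(D0 _ DX) f0; apply/ffunP => i; rewrite f0 // ffunE.
  by move=> _ ->; case: (Dsub X DX).
pose i := Ordinal ltkn.
apply: (@finite_chain_devissage _ (supported_below k)) => //.
- by move=> j _; rewrite ffunE.
- by move=> X /Dsub[].
- apply: (IH (ltnW ltkn)).
  + by move=> _ [X DX <-]; apply/submodule_setI_supported/Dsub.
  + by move=> _ [X _ <-] f [].
  + by apply: total_on_image totD => X Y _ _ XY f [Xf ?]; split=> //; apply: XY.
have finI : finite_set [set [set f i | f in X] | X in D].
  apply: artinian_finite_chain => //.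
    by move=> _ [X DX <-]; apply/ideal_coordinate/Dsub.
  by apply: total_on_image totD => X Y _ _ XY; apply: image_subset.
(* For X supported below k.+1, the sum of X and supported_below k is the inverse
   image of the ideal of ith coordinates of X. *)
pose lift I := supported_below k.+1 `&` [set f | I (f i)].
apply: sub_finite_set (finite_image lift finI) => _ [X DX <-].
exists [set f i | f in X]; first by exists X.
apply/seteqP; split=> [f [fk [g Xg gfi]]|_ [g Xg [h hk <-]]].
  exists g => //; exists (f - g); last by rewrite addrC subrK.
  move=> j; rewrite !ffunE leq_eqVlt => /predU1P[kj|ltkj].
    have <- : i = j by apply: val_inj.
    by rewrite gfi subrr.
  by rewrite fk // (Dk X DX g Xg) ?subrr.
split=> [j kj|]; first by rewrite !ffunE (Dk X DX g Xg) ?hk ?addr0 // ltnW.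
by exists g; rewrite ?ffunE ?hk ?addr0.
Qed.

(** * Subrings attached to ideals *)

(** For an ideal I this is diag R + I^n, the inverse image of the diagonal of
(R / I)^n. *)
Definition congruent_coordinates (I : set R) : set {ffun 'I_n -> R} :=
  [set f | forall i j, I (f i - f j)].

Lemma congruent_coordinates_intermediate (I : set R) : ideals R I ->
  intermediate_rings (@diag n R) (congruent_coordinates I).
Proof.
move=> idI; split=> [|_ [a _ <-] i j]; last first.
  by rewrite !ffunE subrr; apply: ideal0.
split=> [|f g /set_mem fI /set_mem gI|f g /set_mem fI /set_mem gI];
  apply/mem_set => i j.
- by rewrite !ffunE subrr; apply: ideal0.
- by rewrite !ffunE opprD addrACA -opprD; apply: idealB.
- rewrite !ffunE -(subrK (f i * g j) (f i * g i)) -mulrBr -addrA -mulrBl.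
  by rewrite [_ * g j]mulrC; apply: idealD => //; apply: idealM.
Qed.

End Power.

(** * The characterization *)

Theorem proposition1p5 (R : comNzRingType) (n : nat) (hn : (2 <= n)%N) :
  FCP (@diag n R) <-> artinian R.
Proof.
split=> [fcp I idI decI|artR C Cint totC]; last first.
  apply: finite_chain_submodules => // A /Cint[[A1 AB AM] Adiag].
  split=> [|f g /mem_set Af /mem_set Ag|a f /mem_set Af]; apply/set_mem.
  - by rewrite -(subrr 1); apply: AB.
  - exact: AB.
  - by apply: AM => //; apply/mem_set/Adiag; exists a.
pose A k := @congruent_coordinates R n (I k).
have decA k : A k.+1 `<=` A k by move=> f fI i j; apply/decI/fI.
have [|N stabA] := antitone_finite_range_stationary decA.
  apply: fcp => [_ [k _ <-]|].
    exact: congruent_coordinates_intermediate (idI k).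
  move=> _ _ [k _ <-] [l _ <-].
  by case/orP: (leq_total k l) => /(antitone_le decA); [right|left].
(* The vector e x lies in A k exactly when x lies in I k; the coordinate i1,
   where e x vanishes, is available because n is at least 2. *)
pose i0 := Ordinal (ltnW hn); pose i1 := Ordinal hn.
pose e x : {ffun 'I_n -> R} := [ffun i => if i == i0 then x else 0].
have eP k x : I k x <-> A k (e x).
  split=> [Ix i j|/(_ i0 i1)]; last by rewrite !ffunE /= subr0.
  rewrite !ffunE; apply: idealB => //; by case: ifP => // _; apply: ideal0.
exists N => k /stabA AkN; apply/seteqP.
by split=> x /eP; [rewrite AkN|rewrite -AkN] => /eP.
Qed.
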